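(* Let $\pi=(L_x,L_y,L_{xy},\mu_x,\mu_y,\mu_{xy},\mu_{yx})$ be an arbitrary admissible parameter vector, and let $R_x>0$ and $\epsilon>0$ be an arbitrary distance and precision, respectively. Let $\delta_x=\mu_x+\mu_{xy}^2/L_y$ and $\delta_y=\mu_y+\mu_{yx}^2/L_x$, and suppose that the condition $\min\{\delta_x,\delta_y\}>0$ does not hold, i.e., without loss of generality, $\delta_x=0$. Then there exists a $\pi$-regular saddle-point problem $\min_{x\in\mathcal X}\max_{y\in\mathcal Y} f(x)+\langle y,\mathbf Bx\rangle-g(y)$ such that $\mathrm{dist}(0;\mathcal S_x)=R_x$, and for any first-order saddle-point optimization method and any execution time $\tau>0$ the following inequality holds: $$\mathrm{dist}^2(x_o(\tau);\mathcal S_x)>\tfrac18 R_x^2.$$ Moreover, to reach precision $P(x_o(\tau))-D(y_o(\tau))<\epsilon$ on the primal-dual gap by any first-order saddle-point optimization method, the execution time $\tau$ must satisfy $$\tau\ \ge\ \Omega\Big(\tau_f\cdot\mathrm{dist}(0;\mathcal S_x)\sqrt{L_x/\epsilon}\Big),$$ where $\Omega(\cdot)$ hides universal constants.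
   Context: **Problem.** $\mathcal X=\mathbb R^{d_x}$, $\mathcal Y=\mathbb R^{d_y}$ are finite-dimensional Euclidean spaces, $\mathbf B\in\mathbb R^{d_y\times d_x}$, and $f:\mathcal X\to\mathbb R$, $g:\mathcal Y\to\mathbb R$ are differentiable convex functions. The problem is $\min_{x\in\mathcal X}\max_{y\in\mathcal Y} f(x)+\langle y,\mathbf Bx\rangle-g(y)$. For a differentiable $h$, $\mathrm D_h(x,x')=h(x)-h(x')-\langle\nabla h(x'),x-x'\rangle$. A differentiable function $h$ is $\mu$-strongly convex ($\mu\ge0$) if $\mathrm D_h(x,x')\ge\frac{\mu}{2}\|x-x'\|^2$ for all $x,x'$ (convex if this holds with $\mu=0$), and a differentiable convex $h$ is $L$-smooth ($L\ge0$) if $|\mathrm D_h(x,x')|\le\frac L2\|x-x'\|^2$ for all $x,x'$. **Parameters.** $\pi=(L_x,L_y,L_{xy},\mu_x,\mu_y,\mu_{xy},\mu_{yx})\in\mathbb R_+^7$ is admissible if $L_x>\mu_x\ge0$, $L_y>\mu_y\ge0$, $L_{xy}>\mu_{xy}\ge0$, $L_{xy}>\mu_{yx}\ge0$, and $\mu_{xy}=\mu_{yx}$ whenever both $\mu_{xy}>0$ and $\mu_{yx}>0$. The problem is $\pi$-regular if: - $f$ is $\mu_x$-strongly convex and $L_x$-smooth; $g$ is $\mu_y$-strongly convex and $L_y$-smooth; - $\mu_{xy}^2\le\lambda_{\min}^+(\mathbf B^\top\mathbf B)$ if $\nabla f(x)\in\mathrm{range}\,\mathbf B^\top$ for all $x\in\mathcal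 X$, and $\mu_{xy}^2\le\lambda_{\min}(\mathbf B^\top\mathbf B)$ otherwise; - $\mu_{yx}^2\le\lambda_{\min}^+(\mathbf B\mathbf B^\top)$ if $\nabla g(y)\in\mathrm{range}\,\mathbf B$ for all $y\in\mathcal Y$, and $\mu_{yx}^2\le\lambda_{\min}(\mathbf B\mathbf B^\top)$ otherwise; - $L_{xy}^2\ge\lambda_{\max}(\mathbf B^\top\mathbf B)=\lambda_{\max}(\mathbf B\mathbf B^\top)$. Here $\lambda_{\min},\lambda_{\min}^+,\lambda_{\max}$ are the smallest, smallest positive and largest eigenvalues. **Primal and dual.** $P(x)=f(x)+g^*(\mathbf Bx)$, $D(y)=-g(y)-f^*(-\mathbf B^\top y)$, where $h^*$ is the Fenchel conjugate of $h$; $\mathcal S_x=\mathrm{Argmin}_{x\in\mathcal X}P(x)$. $\mathrm{dist}(x;\mathcal A)=\min_{x'\in\mathcal A}\|x-x'\|$. **First-order saddle-point optimization method** with gradient computation times $\tau_f,\tau_g>0$ and matrix-vector computation time $\tau_{\mathbf B}>0$: an algorithm which at every time $\tau\ge0$ maintains a memory $\mathcal M(\tau)=\mathcal M_x(\tau)\times\mathcal M_y(\tau)$, $\mathcal M_x(\tau)\subset\mathcal X$, $\mathcal M_y(\tau)\subset\mathcal Y$, with $\mathcal M_x(0)=\{0\}$, $\mathcal M_y(0)=\{0\}$, and $$\mathcal M_x(\tau)\subset\mathcal M_f(\tau)\cup\mathcal M_{\mathbf B^\top}(\tau),\qquad \mathcal M_y(\tau)\subset\mathcal M_g(\tau)\cup\mathcal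 M_{\mathbf B}(\tau),$$ where $\mathcal M_f(\tau)=\mathrm{span}(\{x,\nabla f(x):x\in\mathcal M_x(\tau-\tau_f)\})$ if $\tau\ge\tau_f$ and $\{0\}$ otherwise; $\mathcal M_g(\tau)=\mathrm{span}(\{y,\nabla g(y):y\in\mathcal M_y(\tau-\tau_g)\})$ if $\tau\ge\tau_g$ and $\{0\}$ otherwise; $\mathcal M_{\mathbf B^\top}(\tau)=\mathrm{span}(\{x,\mathbf B^\top y:(x,y)\in\mathcal M(\tau-\tau_{\mathbf B})\})$ if $\tau\ge\tau_{\mathbf B}$ and $\{0\}$ otherwise; $\mathcal M_{\mathbf B}(\tau)=\mathrm{span}(\{\mathbf Bx,y:(x,y)\in\mathcal M(\tau-\tau_{\mathbf B})\})$ if $\tau\ge\tau_{\mathbf B}$ and $\{0\}$ otherwise. At every time $\tau\ge0$ the algorithm specifies a single output vector $(x_o(\tau),y_o(\tau))\in\mathcal M(\tau)$.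
   Formalization: The problem may depend on an arbitrary horizon T>0, and the distance bound is proved for every execution time 0<τ≤T: for one fixed finite-dimensional problem and all τ>0 the claim is false, as the memory contains a point of S_x after finite time. *)

(* Defs.v *)
From mathcomp Require Import all_boot all_order all_algebra.
From mathcomp Require Import all_classical all_reals all_analysis.

Set Implicit Arguments.
Unset Strict Implicit.
Unset Printing Implicit Defensive.

Import Order.TTheory GRing.Theory Num.Theory.
Import numFieldNormedType.Exports.

Local Open Scope classical_set_scope.
Local Open Scope ring_scope.

(* The canonical norm on matrices is the sup norm, hence the explicit Euclidean
   structure on column vectors. Differentiability does not depend on this
   choice in finite dimension. *)
Definition dot {R : realType} {n : nat} (u v : 'cV[R]_n) : R :=
  \sum_(i < n) u i 0 * v i 0.

Definition enorm {R : realType} {n : nat} (u : 'cV[R]_n) : R :=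
  Num.sqrt (dot u u).

(* The infimum is a minimum when A is closed and nonempty; it is 0 if A is
   empty. *)
Definition dist {R : realType} {n : nat} (x : 'cV[R]_n) (A : set 'cV[R]_n) : R :=
  inf [set enorm (x - a) | a in A].

(* The span of an arbitrary, possibly infinite, set of vectors. *)
Definition lspan {R : realType} {n : nat} (A : set 'cV[R]_n) : set 'cV[R]_n :=
  [set v | exists2 s : seq 'cV[R]_n,
             (forall u, u \in s -> A u) & v \in span s].

Definition range_mx {R : realType} {m n : nat} (A : 'M[R]_(m, n)) :
  set 'cV[R]_m := range (fun x : 'cV[R]_n => A *m x).

Definition grad {R : realType} {n : nat} (h : 'cV[R]_n -> R) (x : 'cV[R]_n) :
  'cV[R]_n := \col_i 'D_(delta_mx i 0) h x.

Definition bregman {R : realType} {n : nat} (h : 'cV[R]_n -> R)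
  (x x' : 'cV[R]_n) : R := h x - h x' - dot (grad h x') (x - x').

Definition strongly_convex {R : realType} {n : nat} (mu : R)
    (h : 'cV[R]_n -> R) : Prop :=
  (forall x, differentiable h x) /\
  (forall x x', mu / 2 * enorm (x - x') ^+ 2 <= bregman h x x').

Definition smooth {R : realType} {n : nat} (L : R) (h : 'cV[R]_n -> R) : Prop :=
  strongly_convex 0 h /\
  (forall x x', `|bregman h x x'| <= L / 2 * enorm (x - x') ^+ 2).

(* These are used on symmetric matrices of positive size, whose spectrum is
   finite and nonempty. A zero matrix has no positive eigenvalue and gets
   lambda_min_pos = 0, so that the bound mu ^+ 2 <= lambda_min_pos then only
   allows mu = 0. *)
Definition lambda_min {R : realType} {n : nat} (A : 'M[R]_n) : R :=
  inf [set a | eigenvalue A a].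

Definition lambda_min_pos {R : realType} {n : nat} (A : 'M[R]_n) : R :=
  inf [set a | eigenvalue A a /\ 0 < a].

Definition lambda_max {R : realType} {n : nat} (A : 'M[R]_n) : R :=
  sup [set a | eigenvalue A a].

Record params (R : realType) := Params {
  Lx : R; Ly : R; Lxy : R; mux : R; muy : R; muxy : R; muyx : R }.

Definition admissible {R : realType} (p : params R) : Prop :=
  [/\ 0 <= mux p < Lx p, 0 <= muy p < Ly p,
      0 <= muxy p < Lxy p, 0 <= muyx p < Lxy p
    & 0 < muxy p -> 0 < muyx p -> muxy p = muyx p].

Definition delta_x {R : realType} (p : params R) : R :=
  mux p + muxy p ^+ 2 / Ly p.

Definition delta_y {R : realType} (p : params R) : R :=
  muy p + muyx p ^+ 2 / Lx p.

(* A problem is given by B, f and g; [regular p B f g] includes the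
   differentiability and the convexity of f and g. *)
Record regular {R : realType} (p : params R) {dx dy : nat}
    (B : 'M[R]_(dy, dx)) (f : 'cV[R]_dx -> R) (g : 'cV[R]_dy -> R) : Prop := {
  regular_f : strongly_convex (mux p) f /\ smooth (Lx p) f;
  regular_g : strongly_convex (muy p) g /\ smooth (Ly p) g;
  regular_muxy :
    ((forall x, range_mx B^T (grad f x)) ->
       muxy p ^+ 2 <= lambda_min_pos (B^T *m B)) /\
    (~ (forall x, range_mx B^T (grad f x)) ->
       muxy p ^+ 2 <= lambda_min (B^T *m B));
  regular_muyx :
    ((forall y, range_mx B (grad g y)) ->
       muyx p ^+ 2 <= lambda_min_pos (B *m B^T)) /\
    (~ (forall y, range_mx B (grad g y)) ->
       muyx p ^+ 2 <= lambda_min (B *m B^T));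
  regular_Lxy : lambda_max (B^T *m B) <= Lxy p ^+ 2 }.

Definition fenchel {R : realType} {n : nat} (h : 'cV[R]_n -> R)
  (z : 'cV[R]_n) : \bar R := ereal_sup (range (fun x => (dot z x - h x)%:E)).

Definition primal {R : realType} {dx dy : nat} (B : 'M[R]_(dy, dx))
    (f : 'cV[R]_dx -> R) (g : 'cV[R]_dy -> R) (x : 'cV[R]_dx) : \bar R :=
  ((f x)%:E + fenchel g (B *m x))%E.

Definition dual {R : realType} {dx dy : nat} (B : 'M[R]_(dy, dx))
    (f : 'cV[R]_dx -> R) (g : 'cV[R]_dy -> R) (y : 'cV[R]_dy) : \bar R :=
  ((- g y)%:E - fenchel f (- (B^T *m y)))%E.

Definition primal_solutions {R : realType} {dx dy : nat} (B : 'M[R]_(dy, dx))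
    (f : 'cV[R]_dx -> R) (g : 'cV[R]_dy -> R) : set 'cV[R]_dx :=
  [set x | forall x', (primal B f g x <= primal B f g x')%E].

Definition delayed {R : realType} {n : nat} (t0 : R) (M : R -> set 'cV[R]_n)
  (t : R) : set 'cV[R]_n := if t0 <= t then M (t - t0) else [set 0].

Definition grad_span {R : realType} {n : nat} (h : 'cV[R]_n -> R)
  (M : set 'cV[R]_n) : set 'cV[R]_n := lspan (M `|` [set grad h x | x in M]).

Definition mulBT_span {R : realType} {dx dy : nat} (B : 'M[R]_(dy, dx))
    (M : set ('cV[R]_dx * 'cV[R]_dy)) : set 'cV[R]_dx :=
  lspan ([set z.1 | z in M] `|` [set B^T *m z.2 | z in M]).

Definition mulB_span {R : realType} {dx dy : nat} (B : 'M[R]_(dy, dx))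
    (M : set ('cV[R]_dx * 'cV[R]_dy)) : set 'cV[R]_dy :=
  lspan ([set B *m z.1 | z in M] `|` [set z.2 | z in M]).

(* An execution of a first-order saddle-point optimization method on the
   problem (B, f, g): its memory and its output at every time t >= 0 (the
   values at negative times are irrelevant). *)
Record fo_method {R : realType} (tf tg tB : R) {dx dy : nat}
    (B : 'M[R]_(dy, dx)) (f : 'cV[R]_dx -> R) (g : 'cV[R]_dy -> R) := FoMethod {
  mem_x : R -> set 'cV[R]_dx;
  mem_y : R -> set 'cV[R]_dy;
  out_x : R -> 'cV[R]_dx;
  out_y : R -> 'cV[R]_dy;
  mem_x0 : mem_x 0 = [set 0];
  mem_y0 : mem_y 0 = [set 0];
  mem_xP : forall t, 0 <= t ->
    mem_x t `<=` delayed tf (fun s => grad_span f (mem_x s)) t `|`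
                 delayed tB (fun s => mulBT_span B (mem_x s `*` mem_y s)) t;
  mem_yP : forall t, 0 <= t ->
    mem_y t `<=` delayed tg (fun s => grad_span g (mem_y s)) t `|`
                 delayed tB (fun s => mulB_span B (mem_x s `*` mem_y s)) t;
  out_xP : forall t, 0 <= t -> mem_x t (out_x t);
  out_yP : forall t, 0 <= t -> mem_y t (out_y t) }.

(* Main.v *)
(* The problem decouples into two "zero-chains", each a quadratic
   k * |A (v - s)|^2 with A lower bidiagonal and A s supported on the first
   coordinate, so that one gradient step reveals at most one new coordinate.
   The variable is x = (u, v), B = muyx * [I 0] only acts on u, and
     f(u, v) = Lx/2 |u|^2 - muyx <y0, u> + Lx/8 |A (v - s)|^2,
     g(y) = k |A' (y - y0)|^2,
   where the linear term in u cancels the contribution of g^* to the first-order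
   condition, so that x = (0, s) is the only primal solution and the gap is at
   least g(y) + Lx/8 |A (v - s)|^2.
   - s takes a large value on a first block, whose length is of the order of
     Rx * sqrt (Lx / eps), and a small value on a second, much longer block; each
     block carries half of Rx^2. The first block keeps the function value above
     eps, the second one keeps the iterates far from the solution until time T.
   - For small Rx^2 * Lx / eps the gap in v alone may be below eps from the
     start. There the chain in y is used: y0 decreases geometrically, with ratio
     chosen so that g is muy-strongly convex and Ly-smooth, it is longer than
     tf / tg, and its last entry is so large that g(y) >= eps before time tf. *)
Require Import Defs.
From HB Require Import structures.
From mathcomp Require Import all_boot all_order all_algebra.
From mathcomp Require Import all_classical all_reals all_analysis.
From mathcomp Require Import zify ring lra.

Set Implicit Arguments.
Unset Strict Implicit.
Unset Printing Implicit Defensive.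

Import Order.TTheory GRing.Theory Num.Theory.
Import numFieldNormedType.Exports.

Local Open Scope classical_set_scope.
Local Open Scope ring_scope.

(** * Inner product and gradients *)

Lemma dotE (R : realType) n (u v : 'cV[R]_n) : dot u v = (u^T *m v) 0 0.
Proof. by rewrite mxE; apply: eq_bigr => i _; rewrite mxE. Qed.

Lemma dotC (R : realType) n (u v : 'cV[R]_n) : dot u v = dot v u.
Proof. by apply: eq_bigr => i _; rewrite mulrC. Qed.

Lemma dotDr (R : realType) n (w u v : 'cV[R]_n) : dot w (u + v) = dot w u + dot w v.
Proof. by rewrite !dotE mulmxDr mxE. Qed.

Lemma dotZr (R : realType) n a (u v : 'cV[R]_n) : dot u (a *: v) = a * dot u v.
Proof. by rewrite !dotE -scalemxAr mxE. Qed.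

Lemma dotNr (R : realType) n (u v : 'cV[R]_n) : dot u (- v) = - dot u v.
Proof. by rewrite -scaleN1r dotZr mulN1r. Qed.

Lemma dotBr (R : realType) n (w u v : 'cV[R]_n) : dot w (u - v) = dot w u - dot w v.
Proof. by rewrite dotDr dotNr. Qed.

Lemma dotDl (R : realType) n (w u v : 'cV[R]_n) : dot (u + v) w = dot u w + dot v w.
Proof. by rewrite dotC dotDr !(dotC w). Qed.

Lemma dotZl (R : realType) n a (u v : 'cV[R]_n) : dot (a *: u) v = a * dot u v.
Proof. by rewrite dotC dotZr dotC. Qed.

Lemma dotNl (R : realType) n (u v : 'cV[R]_n) : dot (- u) v = - dot u v.
Proof. by rewrite dotC dotNr dotC. Qed.

Lemma dotBl (R : realType) n (w u v : 'cV[R]_n) : dot (u - v) w = dot u w - dot v w.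
Proof. by rewrite dotDl dotNl. Qed.

Lemma dot0r (R : realType) n (u : 'cV[R]_n) : dot u 0 = 0.
Proof. by rewrite dotE mulmx0 mxE. Qed.

Lemma dot0l (R : realType) n (u : 'cV[R]_n) : dot 0 u = 0.
Proof. by rewrite dotC dot0r. Qed.

Lemma dot_mulmxl (R : realType) m n (A : 'M[R]_(m, n)) u v :
  dot (A *m u) v = dot u (A^T *m v).
Proof. by rewrite !dotE trmx_mul mulmxA. Qed.

Lemma dot_ge0 (R : realType) n (u : 'cV[R]_n) : 0 <= dot u u.
Proof. by apply: sumr_ge0 => i _; rewrite -expr2 sqr_ge0. Qed.

Lemma sqr_enorm (R : realType) n (u : 'cV[R]_n) : enorm u ^+ 2 = dot u u.
Proof. by rewrite sqr_sqrtr // dot_ge0. Qed.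

Lemma sqr_coord_le_dot (R : realType) n (u : 'cV[R]_n) i : u i 0 ^+ 2 <= dot u u.
Proof.
rewrite /dot (bigD1 i) //= expr2 lerDl; apply: sumr_ge0 => j _.
by rewrite -expr2 sqr_ge0.
Qed.

Lemma dot_eq0 (R : realType) n (u : 'cV[R]_n) : dot u u <= 0 -> u = 0.
Proof.
move=> u0; apply/colP => i; rewrite mxE; apply/eqP.
by rewrite -sqrf_eq0 eq_le sqr_ge0 (le_trans (sqr_coord_le_dot u i)).
Qed.

Lemma dot_block (R : realType) m n (x x' : 'cV[R]_(m + n)) :
  dot x x' = dot (usubmx x) (usubmx x') + dot (dsubmx x) (dsubmx x').
Proof. by rewrite /dot big_split_ord; congr (_ + _); apply: eq_bigr => i _; rewrite !mxE. Qed.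

Lemma coord_le_norm (R : realType) n (u : 'cV[R]_n.+1) i : `|u i 0| <= `|u|.
Proof.
by rewrite [leRHS]/Num.Def.normr /= mx_normrE; apply: (le_trans _ (le_bigmax _ _ (i, 0))).
Qed.

(** Carries Euclidean remainder bounds over to the canonical sup norm, in which differentials are
    defined. *)
Lemma dot_le_norm (R : realType) n (u : 'cV[R]_n.+1) : dot u u <= n.+1%:R * `|u| ^+ 2.
Proof.
have -> : n.+1%:R * `|u| ^+ 2 = \sum_(i < n.+1) `|u| ^+ 2.
  by rewrite sumr_const card_ord mulr_natl.
apply: ler_sum => i _; rewrite -expr2 -real_normK ?num_real//.
by rewrite lerXn2r ?nnegrE// coord_le_norm.
Qed.

Lemma dot_continuous (R : realType) n (g : 'cV[R]_n.+1) : continuous (dot g).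
Proof.
move=> x; apply: differentiable_continuous.
have -> : dot g = \sum_(i < n.+1) (g i 0 *: fun v : 'cV[R]_n.+1 => v i 0 : R).
  by apply/funext => v; rewrite fct_sumE; apply: eq_bigr => i _.
by apply: differentiable_sum => i; apply/differentiableZ/differentiable_coord.
Qed.

(** The remainder is at most [e] times the norm of [v] once that norm is below [e / (|K| + 1)]; the
    [+ 1] keeps the denominator positive. *)
Lemma littleo_quadratic_remainder (R : realType) (V W : normedModType R)
    (h : V -> W) (df : {linear V -> W}) (K : R) (x : V) :
  (forall v, `|h (v + x) - h x - df v| <= K * `|v| ^+ 2) ->
  h \o shift x = cst (h x) + df +o_ 0 id.
Proof.
move=> hK; apply/eqaddoP => _/posnumP[e].
have K0 : 0 < `|K| + 1 by rewrite ltr_wpDl.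
near=> v.
rewrite /= [X in `|X|](_ : _ = h (v + x) - h x - df v); last first.
  by rewrite /= opprD addrA.
apply: le_trans (hK v) _.
have : `|v| <= e%:num / (`|K| + 1).
  near: v; apply/nbhs_ballP; exists (e%:num / (`|K| + 1)) => /=.
    exact: divr_gt0.
  by move=> v; rewrite -ball_normE /= sub0r normrN => /ltW.
rewrite ler_pdivlMr// => vK.
apply: (@le_trans _ _ (`|K| * `|v| ^+ 2)).
  by rewrite ler_wpM2r ?ler_norm ?exprn_ge0.
have v0 := normr_ge0 v.
apply: (@le_trans _ _ (`|v| * (`|K| + 1) * `|v|)); last exact: ler_wpM2r.
by rewrite expr2; nra.
Unshelve. all: by end_near. Qed.

Lemma dot_is_linear (R : realType) n (g : 'cV[R]_n.+1) :
  linear (dot g : 'cV[R]_n.+1 -> R^o).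
Proof. by move=> a u v; rewrite dotDr dotZr. Qed.

HB.instance Definition _ (R : realType) n (g : 'cV[R]_n.+1) :=
  GRing.isLinear.Build _ _ R^o _ (dot g) (dot_is_linear g).

Section quadratic_remainder.
Variables (R : realType) (n : nat) (h : 'cV[R]_n.+1 -> R).
Variables (G : 'cV[R]_n.+1 -> 'cV[R]_n.+1) (C : R).
Hypothesis hG : forall x x',
  `|h x - h x' - dot (G x') (x - x')| <= C * dot (x - x') (x - x').

(** A first-order expansion determines the differential by uniqueness, so no partial derivative has
    to be computed. *)
Let diff_dot x : differentiable h x /\ 'd h x = dot (G x) :> ('cV[R]_n.+1 -> R).
Proof.
have ho : forall v, `|(h : 'cV[R]_n.+1 -> R^o) (v + x) - h x -
    (dot (G x) : {linear 'cV[R]_n.+1 -> R^o}) v|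
    <= `|C| * n.+1%:R * `|v| ^+ 2.
  move=> v; apply: (@le_trans _ _ (C * dot v v)).
    by have := hG (v + x) x; rewrite addrK.
  rewrite -mulrA; apply: (@le_trans _ _ (`|C| * dot v v)).
    by rewrite ler_wpM2r ?dot_ge0 ?ler_norm.
  by rewrite ler_wpM2l ?dot_le_norm.
have cG : continuous (dot (G x) : {linear 'cV[R]_n.+1 -> R^o}) by exact: dot_continuous.
have dh := littleo_quadratic_remainder ho.
have dhE := diff_unique cG dh.
by split => //; apply/diff_locallyP; rewrite dhE.
Qed.

Lemma differentiable_quadratic_remainder x : differentiable h x.
Proof. by have [] := diff_dot x. Qed.

Lemma grad_quadratic_remainder x : grad h x = G x.
Proof.
have [dh dhE] := diff_dot x; apply/colP => i; rewrite mxE deriveE//.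
rewrite dhE /dot (bigD1 i)//= big1 => [|j ji].
  by rewrite mxE !eqxx mulr1 addr0.
by rewrite mxE (negbTE ji) mulr0.
Qed.

End quadratic_remainder.

(** * Bidiagonal chains *)

Section chain.
Variables (R : realType) (n : nat) (s : nat -> R).
Implicit Types v : 'cV[R]_n.+1.

(* Row [i + 1] of [chain_mx *m v] is [v_(i+1) - (s_(i+1) / s_i) v_i], so that it
   vanishes at [v = s]. *)
Definition chain_mx : 'M[R]_n.+1 :=
  \matrix_(i, j) ((i == j)%:R - (s i / s j) *+ (j.+1 == i)%N).

Definition chain_sol : 'cV[R]_n.+1 := \col_i s i.

Let prev (i : 'I_n) : 'I_n.+1 := widen_ord (leqnSn n) i.

Lemma chain_mx0 v : (chain_mx *m v) 0 0 = v 0 0.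
Proof.
rewrite mxE (bigD1 ord0)//= big1 => [|j j0]; rewrite mxE /= subr0.
  by rewrite mul1r addr0.
by rewrite eq_sym (negbTE j0) mul0r.
Qed.

Lemma chain_mxS v (i : 'I_n) :
  (chain_mx *m v) (lift ord0 i) 0 =
  v (lift ord0 i) 0 - s i.+1 / s i * v (prev i) 0.
Proof.
have ip : lift ord0 i != prev i by rewrite -val_eqE /= /bump /=; lia.
rewrite mxE (bigD1 (lift ord0 i))// (bigD1 (prev i)) 1?eq_sym//= big1 => [|j].
  rewrite !mxE !lift0 !eqxx (negbTE ip) sub0r mulNr mulr1n addr0.
  by rewrite -[_ == _]/(i.+2 == i.+1) gtn_eqF ?mulr0n ?subr0 ?mul1r.
case/andP => j1 j2; rewrite mxE !lift0 eq_sym (negbTE j1) sub0r eqSS.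
move: j2; rewrite -val_eqE /= => /negbTE ->.
by rewrite mulr0n oppr0 mul0r.
Qed.

Lemma dot_chain_mx v : dot (chain_mx *m v) (chain_mx *m v) =
  v 0 0 ^+ 2 +
  \sum_(i < n) (v (lift ord0 i) 0 - s i.+1 / s i * v (prev i) 0) ^+ 2.
Proof.
rewrite /dot big_ord_recl chain_mx0 -expr2; congr (_ + _).
by apply: eq_bigr => i _; rewrite chain_mxS expr2.
Qed.

Hypothesis s_gt0 : forall i, 0 < s i.

Lemma chain_mx_sol (i : 'I_n) : (chain_mx *m chain_sol) (lift ord0 i) 0 = 0.
Proof. by rewrite chain_mxS !mxE /= /bump add1n divfK ?subrr// gt_eqF. Qed.

(** The matrix is lower triangular with unit diagonal, so its determinant is 1. *)
Lemma chain_mx_inj v : chain_mx *m v = 0 -> v = 0.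
Proof.
move=> Av0; have Au : chain_mx \in unitmx.
  rewrite unitmxE det_trig.
    rewrite big1 ?unitr1// => i _.
    by rewrite mxE eqxx gtn_eqF ?mulr0n ?subr0.
  apply/is_trig_mxP => i j ij; rewrite mxE -val_eqE /= ltn_eqF//.
  by rewrite gtn_eqF ?mulr0n ?subr0// ltnS ltnW.
by rewrite -[v](mulKmx Au) Av0 mulmx0.
Qed.

(** The zero-chain property. Entry [i] of the gradient only sees residual rows [i] and [i + 1],
    hence entries of [v] from [i - 1] on; [chain_sol] only contributes to row 0, excluded by
    [0 < i]. *)
Lemma chain_grad_support v (i : 'I_n.+1) :
  (0 < i)%N -> (forall j : 'I_n.+1, (i <= j.+1)%N -> v j 0 = 0) ->
  (chain_mx^T *m (chain_mx *m (v - chain_sol))) i 0 = 0.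
Proof.
move=> i0 vi0; rewrite mxE big1// => j _; rewrite mxE.
have [ij|ji] := leqP i j; last first.
  rewrite mxE -val_eqE /= ltn_eqF// [_ == _]gtn_eqF ?ltnS ?(ltnW ji)//.
  by rewrite mulr0n subr0 mul0r.
case: (unliftP ord0 j) ij => [j'|] -> ij; last by move: ij; rewrite leqNgt i0.
suff -> : (chain_mx *m (v - chain_sol)) (lift ord0 j') 0 = 0 by rewrite mulr0.
rewrite mulmxBr mxE [X in _ + X]mxE chain_mx_sol subr0 chain_mxS.
by move: ij; rewrite lift0 => ij; rewrite !vi0 ?lift0 ?mulr0 ?subr0 ?mulr0// ltnW.
Qed.

Variable al : R.
Hypothesis al01 : 0 <= al <= 1.
Hypothesis s_decr : forall i, s i.+1 <= al * s i.

Let ratio i : 0 <= s i.+1 / s i <= al.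
Proof.
by rewrite ler_pdivrMr// s_decr andbT divr_ge0// ltW.
Qed.

(** The matrix is the identity minus a shift with weights [r <= al]. Each row is bounded through [(x
    - r y)^2 <= (1 + r) x^2 + (1 + r) r y^2]; the sum is closed by splitting off the first or the
    last entry of [v]. *)
Lemma dot_chain_mx_le v :
  dot (chain_mx *m v) (chain_mx *m v) <= (1 + al) ^+ 2 * dot v v.
Proof.
have v1 : dot v v = v 0 0 ^+ 2 + \sum_(i < n) v (lift ord0 i) 0 ^+ 2.
  by rewrite /dot big_ord_recl.
have v2 : dot v v = \sum_(i < n) v (prev i) 0 ^+ 2 + v ord_max 0 ^+ 2.
  by rewrite /dot big_ord_recr.
have: \sum_(i < n) (v (lift ord0 i) 0 - s i.+1 / s i * v (prev i) 0) ^+ 2 <=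
   \sum_(i < n) ((1 + al) * v (lift ord0 i) 0 ^+ 2 + (1 + al) * al * v (prev i) 0 ^+ 2).
  apply: ler_sum => i _.
  set x := v _ _; set y := v _ _; have := ratio i; set r := _ / _ => /andP[r0 ral].
  apply: (@le_trans _ _ ((1 + r) * x ^+ 2 + (1 + r) * r * y ^+ 2)).
    rewrite -subr_ge0 [X in 0 <= X](_ : _ = r * (x + y) ^+ 2); last by ring.
    by rewrite mulr_ge0 ?sqr_ge0.
  apply: lerD; rewrite ler_wpM2r ?sqr_ge0//; nra.
rewrite big_split -!mulr_sumr dot_chain_mx /=.
have := sqr_ge0 (v 0 0); have := sqr_ge0 (v ord_max 0).
move: v1 v2; set a := dot v v; set b := v 0 0 ^+ 2; set c := \sum_(i < n) _.
set d := \sum_(i < n) _; set e := v ord_max 0 ^+ 2; set f := \sum_(i < n) _.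
case/andP: al01 => al0 al1 v1 v2 e0 b0 fle.
have -> : (1 + al) ^+ 2 * a = (1 + al) * (b + c) + (1 + al) * al * (d + e).
  by rewrite -v1 -v2; ring.
have : 0 <= (1 + al) * al * e by rewrite (mulr_ge0 _ e0) ?mulr_ge0 ?addr_ge0.
have : 0 <= al * b := mulr_ge0 al0 b0.
by lra.
Qed.

(** The companion bound rests on [(x - r y)^2 >= (1 - al) x^2 - (1 - al) al y^2] in each row. *)
Lemma dot_chain_mx_ge v :
  (1 - al) ^+ 2 * dot v v <= dot (chain_mx *m v) (chain_mx *m v).
Proof.
have v1 : dot v v = v 0 0 ^+ 2 + \sum_(i < n) v (lift ord0 i) 0 ^+ 2.
  by rewrite /dot big_ord_recl.
have v2 : dot v v = \sum_(i < n) v (prev i) 0 ^+ 2 + v ord_max 0 ^+ 2.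
  by rewrite /dot big_ord_recr.
have: \sum_(i < n) ((1 - al) * v (lift ord0 i) 0 ^+ 2 - (1 - al) * al * v (prev i) 0 ^+ 2) <=
   \sum_(i < n) (v (lift ord0 i) 0 - s i.+1 / s i * v (prev i) 0) ^+ 2.
  apply: ler_sum => i _.
  set x := v _ _; set y := v _ _; have := ratio i; set r := _ / _ => /andP[r0 ral].
  case/andP: al01 => al0 al1; rewrite -subr_ge0.
  (* The square is completed after multiplication by [al], so [al = 0], which forces [r = 0], is
     treated apart. *)
  have [al00|alN0] := eqVneq al 0.
    have r00 : r = 0 by lra.
    by rewrite al00 r00; have := sqr_ge0 x; nra.
  rewrite -(pmulr_rge0 _ (_ : 0 < al)); last by rewrite lt0r alN0.
  rewrite [X in 0 <= X](_ : _ =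
    (al * x - r * y) ^+ 2 + (1 - al) * ((al - r) * (al + r)) * y ^+ 2); last by ring.
  rewrite addr_ge0 ?sqr_ge0// mulr_ge0 ?sqr_ge0// mulr_ge0 ?subr_ge0//.
  by rewrite mulr_ge0 ?subr_ge0// addr_ge0.
rewrite sumrB -!mulr_sumr dot_chain_mx /=.
have := sqr_ge0 (v 0 0); have := sqr_ge0 (v ord_max 0).
move: v1 v2; set a := dot v v; set b := v 0 0 ^+ 2; set c := \sum_(i < n) _.
set d := \sum_(i < n) _; set e := v ord_max 0 ^+ 2; set f := \sum_(i < n) _.
case/andP: al01 => al0 al1 v1 v2 e0 b0 fle.
have -> : (1 - al) ^+ 2 * a = (1 - al) * (b + c) - (1 - al) * al * (d + e).
  by rewrite -v1 -v2; ring.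
have : 0 <= (1 - al) * al * e by rewrite (mulr_ge0 _ e0) ?mulr_ge0 ?subr_ge0.
have : 0 <= al * b := mulr_ge0 al0 b0.
by lra.
Qed.

End chain.

(** On a constant block the residuals are the increments of [w = v - s]. They add up to [w k = - a],
    and Cauchy-Schwarz over [k + 1] terms gives the bound; the induction proves it one entry at a
    time. *)
Lemma chain_gap (R : realType) n (s : nat -> R) (a : R) (v : 'cV[R]_n.+1)
    (k : 'I_n.+1) :
  0 < a -> (forall i, (i <= k)%N -> s i = a) -> v k 0 = 0 ->
  a ^+ 2 <= k.+1%:R * dot (chain_mx n s *m (v - chain_sol n s))
                          (chain_mx n s *m (v - chain_sol n s)).
Proof.
move=> a0 sa vk0; set w := v - _; set r := chain_mx n s *m w.
suff wle : forall j : 'I_n.+1, (j <= k)%N ->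
    w j 0 ^+ 2 <= j.+1%:R * \sum_(i < n.+1 | (i <= j)%N) r i 0 ^+ 2.
  have := wle k (leqnn _); rewrite !mxE vk0 sa// sub0r sqrrN => /le_trans; apply.
  rewrite ler_wpM2l// /dot [leRHS](bigID (fun i : 'I_n.+1 => (i <= k)%N))/=.
  rewrite (eq_bigr (fun i => r i 0 * r i 0)) => [|i _]; last by rewrite expr2.
  by rewrite lerDl sumr_ge0// => i _; rewrite -expr2 sqr_ge0.
case=> j; elim: j => [|j IH] jn /= jk.
  rewrite (bigD1 ord0)// big1 => [|i /andP[]]; last first.
    by rewrite leqn0 => /eqP i0 /eqP; case; exact: val_inj.
  by rewrite mul1r /= addr0 /r chain_mx0 (_ : Ordinal jn = 0)//; exact: val_inj.
have jn' : (j < n.+1)%N by exact: ltnW.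
have := IH jn' (ltnW jk) => /=; set S := \sum_(i < n.+1 | _) _ => wS.
rewrite (bigD1 (Ordinal jn))//= (eq_bigl (fun i : 'I_n.+1 => (i <= j)%N)); last first.
  by move=> i; rewrite -val_eqE /= andbC -ltn_neqAle ltnS.
have j'n : (j < n)%N by [].
have -> : Ordinal jn = lift ord0 (Ordinal j'n) by apply: ord_inj; rewrite lift0.
have := chain_mxS s w (Ordinal j'n); rewrite -/r /= !sa ?(ltnW jk)// divff ?gt_eqF// mul1r.
rewrite (_ : widen_ord _ _ = Ordinal jn'); last exact: val_inj.
rewrite -/S; set x := w _ 0 in wS *; set y := w _ 0; set z := r _ 0 => zE.
have -> : y = x + z by rewrite zE addrC subrK.
have J0 : 0 < j.+1%:R :> R by rewrite ltr0n.
rewrite -[j.+2]addn1 natrD; set J := j.+1%:R in wS J0 *.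
rewrite -(ler_pM2l J0).
(* This square and the induction hypothesis add up to [J (x + z)^2 <= J (J + 1) (S + z^2)]. *)
have : 0 <= (x - J * z) ^+ 2 by exact: sqr_ge0.
have : 0 <= (J + 1) * (J * S - x ^+ 2).
  by rewrite mulr_ge0 ?subr_ge0// addr_ge0// ltW.
lra.
Qed.

(** * The coupling matrix *)

Section coupling.
Variables (R : realType) (m n : nat) (b : R).

Definition coupling : 'M[R]_(m.+1, m.+1 + n) := b *: row_mx 1%:M 0.

Lemma mul_coupling (x : 'cV_(m.+1 + n)) : coupling *m x = b *: usubmx x.
Proof.
by rewrite -scalemxAl -[x in LHS]vsubmxK mul_row_col mul1mx mul0mx addr0.
Qed.

Lemma mul_tr_coupling (y : 'cV_m.+1) : coupling^T *m y = col_mx (b *: y) 0.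
Proof.
rewrite linearZ /= tr_row_mx -scalemxAl mul_col_mx trmx1 trmx0 mul1mx mul0mx.
by rewrite scale_col_mx scaler0.
Qed.

Lemma coupling_tr : coupling *m coupling^T = (b ^+ 2)%:M.
Proof.
rewrite /coupling linearZ /= -scalemxAl -scalemxAr tr_row_mx mul_row_col.
by rewrite trmx1 trmx0 mulmx1 mulmx0 addr0 scalerA -expr2 scalemx1.
Qed.

Lemma eigenvalue_coupling_tr a :
  eigenvalue (coupling *m coupling^T) a -> a = b ^+ 2.
Proof.
rewrite coupling_tr => /eigenvalueP[v]; rewrite mul_mx_scalar => /eqP.
by rewrite -subr_eq0 -scalerBl scaler_eq0 subr_eq0 => /orP[/eqP->//|->].
Qed.

Lemma eigenvalue_coupling_tr_sqr : eigenvalue (coupling *m coupling^T) (b ^+ 2).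
Proof.
rewrite coupling_tr; apply/eigenvalueP; exists (const_mx 1).
  by rewrite mul_mx_scalar.
by apply/eqP => /rowP /(_ 0); rewrite !mxE => /eqP; rewrite oner_eq0.
Qed.

Lemma lambda_min_coupling_tr : lambda_min (coupling *m coupling^T) = b ^+ 2.
Proof.
rewrite /lambda_min [X in inf X](_ : _ = [set b ^+ 2]) ?inf1//.
apply/seteqP; split => a /=; first exact: eigenvalue_coupling_tr.
by move=> ->; exact: eigenvalue_coupling_tr_sqr.
Qed.

Lemma lambda_min_pos_coupling_tr :
  lambda_min_pos (coupling *m coupling^T) = b ^+ 2.
Proof.
rewrite /lambda_min_pos; have [b0|b0] := eqVneq b 0.
  (* Without positive eigenvalues the infimum takes its default value 0, which is [b ^+ 2] here. *)
  rewrite [X in inf X](_ : _ = set0) ?inf0 ?b0 ?expr0n//.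
  apply/seteqP; split => a //= -[/eigenvalue_coupling_tr ->].
  by rewrite b0 expr0n ltxx.
rewrite [X in inf X](_ : _ = [set b ^+ 2]) ?inf1//.
apply/seteqP; split => a /=; first by case=> /eigenvalue_coupling_tr.
move=> ->; split; first exact: eigenvalue_coupling_tr_sqr.
by rewrite exprn_even_gt0.
Qed.

(** Rayleigh quotient: pairing the eigenvector with itself gives [a |v|^2 = |B v|^2], and [|B v|^2]
    is [b ^+ 2] times the squared norm of the first block of [v]. *)
Lemma eigenvalue_tr_coupling a :
  eigenvalue (coupling^T *m coupling) a -> 0 <= a <= b ^+ 2.
Proof.
move=> /eigenvalueP[v vB v0].
have /(congr1 (fun w => w *m v^T)) := vB; rewrite mulmxA -(mulmxA _ _ v^T).
have -> : v *m coupling^T = (coupling *m v^T)^T by rewrite trmx_mul trmxK.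
rewrite -scalemxAl -{3}[v]trmxK => /matrixP/(_ 0 0); rewrite [RHS]mxE -!dotE.
rewrite mul_coupling dotZl dotZr mulrA -expr2 => bE.
have vv0 : 0 < dot v^T v^T.
  rewrite lt_neqAle dot_ge0 andbT eq_sym; apply: contra v0 => /eqP vv0.
  by rewrite -[v]trmxK (dot_eq0 (u := v^T)) ?vv0// trmx0.
rewrite -(ler_pM2r vv0) -[a <= _](ler_pM2r vv0) mul0r -bE.
rewrite mulr_ge0 ?sqr_ge0 ?dot_ge0//= ler_wpM2l ?sqr_ge0//.
by rewrite (dot_block v^T) lerDl dot_ge0.
Qed.

(** Nonnegativity is enough, since [delta_x p = 0] forces [muxy p = 0]. An empty spectrum is covered
    by the default value of [inf]. *)
Lemma lambda_min_tr_coupling : 0 <= lambda_min (coupling^T *m coupling).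
Proof.
rewrite /lambda_min; set S := [set _ | _].
have [->|/set0P S0] := eqVneq S set0; first by rewrite inf0.
by apply: lb_le_inf => // a /eigenvalue_tr_coupling/andP[].
Qed.

Lemma lambda_min_pos_tr_coupling : 0 <= lambda_min_pos (coupling^T *m coupling).
Proof.
rewrite /lambda_min_pos; set S := [set _ | _].
have [->|/set0P S0] := eqVneq S set0; first by rewrite inf0.
by apply: lb_le_inf => // a -[_ /ltW].
Qed.

Lemma lambda_max_tr_coupling : lambda_max (coupling^T *m coupling) <= b ^+ 2.
Proof.
rewrite /lambda_max; set S := [set _ | _].
have [->|/set0P S0] := eqVneq S set0; first by rewrite sup0 sqr_ge0.
by apply: ge_sup => // a /eigenvalue_tr_coupling/andP[].
Qed.

End coupling.

(** * Memory of a first-order method *)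

Definition subspace (R : realType) n (S : set 'cV[R]_n) :=
  S 0 /\ forall a u v, S u -> S v -> S (a *: u + v).

Lemma lspan_subspace (R : realType) n (S A : set 'cV[R]_n) :
  subspace S -> A `<=` S -> lspan A `<=` S.
Proof.
move=> [S0 SD] AS v [s sA vs]; rewrite (coord_span (X := in_tuple s) vs).
elim/big_ind: _ => // [u w Su Sw|i _].
  by rewrite -[u]scale1r; exact: SD.
by rewrite -[X in S X]addr0; apply: SD => //; apply/AS/sA/mem_nth.
Qed.

(* A family of subspaces indexed by time contains the memory as soon as it is
   stable under each delayed step. No initial condition is needed, because a
   subspace contains 0. *)
Section memory_invariant.
Variables (R : realType) (tf tg tB : R) (dx dy : nat).
Variables (B : 'M[R]_(dy, dx)) (f : 'cV[R]_dx -> R) (g : 'cV[R]_dy -> R).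
Variables (Sx : R -> set 'cV[R]_dx) (Sy : R -> set 'cV[R]_dy).
Hypotheses (tf0 : 0 < tf) (tg0 : 0 < tg) (tB0 : 0 < tB).
Hypothesis Sx_subspace : forall t, subspace (Sx t).
Hypothesis Sy_subspace : forall t, subspace (Sy t).
Hypothesis Sx_grad : forall t x, tf <= t -> Sx (t - tf) x ->
  Sx t x /\ Sx t (grad f x).
Hypothesis Sy_grad : forall t y, tg <= t -> Sy (t - tg) y ->
  Sy t y /\ Sy t (grad g y).
Hypothesis S_mul : forall t x y, tB <= t -> Sx (t - tB) x -> Sy (t - tB) y ->
  [/\ Sx t x, Sy t y, Sx t (B^T *m y) & Sy t (B *m x)].

Lemma memory_invariant (A : fo_method tf tg tB B f g) t : 0 <= t ->
  mem_x A t `<=` Sx t /\ mem_y A t `<=` Sy t.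
Proof.
(* Time is continuous: the induction runs over windows of length [d], the shortest delay, so that
   every step reads an earlier window. *)
pose d := Num.min tf (Num.min tg tB).
have d0 : 0 < d by rewrite !lt_min tf0 tg0 tB0.
have [df [dg dB]] : d <= tf /\ d <= tg /\ d <= tB.
  by rewrite !ge_min !lexx !orbT.
suff main : forall N t, 0 <= t < N%:R * d ->
    mem_x A t `<=` Sx t /\ mem_y A t `<=` Sy t.
  move=> t0; apply: (main (Num.bound (t / d))); rewrite t0/= -ltr_pdivrMr//.
  by apply: archi_boundP; rewrite divr_ge0// ltW.
elim=> [|N IH] {}t /andP[t0]; first by rewrite mul0r ltNge t0.
rewrite -natr1 mulrDl mul1r => tN.
have sub e : d <= e -> e <= t -> mem_x A (t - e) `<=` Sx (t - e) /\
    mem_y A (t - e) `<=` Sy (t - e).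
  by move=> de et; apply: IH; lra.
split=> z.
  move=> /(mem_xP t0)[]; rewrite /delayed; case: ifPn => [et|_].
  - have [sx _] := sub _ df et; apply: lspan_subspace => // x [|[x' Mx' <-]].
      by move=> /sx /(Sx_grad et)[].
    by have [] := Sx_grad et (sx _ Mx').
  - by move=> ->; have [] := Sx_subspace t.
  - have [sx sy] := sub _ dB et.
    apply: lspan_subspace => // _ [|] [[x y] /= [/sx Mx /sy My] <-].
      by have [] := S_mul et Mx My.
    by have [] := S_mul et Mx My.
  - by move=> ->; have [] := Sx_subspace t.
move=> /(mem_yP t0)[]; rewrite /delayed; case: ifPn => [et|_].
- have [_ sy] := sub _ dg et; apply: lspan_subspace => // x [|[x' Mx' <-]].
    by move=> /sy /(Sy_grad et)[].
  by have [] := Sy_grad et (sy _ Mx').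
- by move=> ->; have [] := Sy_subspace t.
- have [sx sy] := sub _ dB et.
  apply: lspan_subspace => // _ [|] [[x y] /= [/sx Mx /sy My] <-].
    by have [] := S_mul et Mx My.
  by have [] := S_mul et Mx My.
- by move=> ->; have [] := Sy_subspace t.
Qed.

End memory_invariant.

(** * The hard problem *)

Section chain_energy.
Variables (R : realType) (k : R) (n : nat) (s : nat -> R).
Implicit Types v : 'cV[R]_n.+1.
Hypotheses (k_ge0 : 0 <= k) (s_gt0 : forall i, 0 < s i).

Definition chain_energy v : R :=
  k * dot (chain_mx n s *m (v - chain_sol n s)) (chain_mx n s *m (v - chain_sol n s)).

Definition chain_grad v : 'cV[R]_n.+1 :=
  (2 * k) *: ((chain_mx n s)^T *m (chain_mx n s *m (v - chain_sol n s))).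

Lemma chain_energy_ge0 v : 0 <= chain_energy v.
Proof. by rewrite mulr_ge0 ?dot_ge0. Qed.

Lemma chain_energy_sol : chain_energy (chain_sol n s) = 0.
Proof. by rewrite /chain_energy subrr mulmx0 dot0r mulr0. Qed.

(** The Bregman divergence of a quadratic is its quadratic form at the difference, whatever the base
    point. *)
Lemma chain_energyB v v' :
  chain_energy v - chain_energy v' - dot (chain_grad v') (v - v') =
  k * dot (chain_mx n s *m (v - v')) (chain_mx n s *m (v - v')).
Proof.
rewrite /chain_energy /chain_grad dotZl [dot (_^T *m _) _]dotC -dot_mulmxl.
set w := v' - _; set d := v - v'.
have -> : v - chain_sol n s = d + w by rewrite /d /w addrA subrK.
rewrite mulmxDr; set a := _ *m d; set c := _ *m w.
by rewrite !dotDr !dotDl (dotC c a); ring.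
Qed.

Variable al : R.
Hypothesis al01 : 0 <= al <= 1.
Hypothesis s_decr : forall i, s i.+1 <= al * s i.

Lemma chain_energy_remainder v v' :
  `|chain_energy v - chain_energy v' - dot (chain_grad v') (v - v')|
    <= k * (1 + al) ^+ 2 * dot (v - v') (v - v').
Proof.
rewrite chain_energyB ger0_norm ?mulr_ge0 ?dot_ge0//.
by rewrite -mulrA ler_wpM2l// dot_chain_mx_le.
Qed.

Lemma differentiable_chain_energy v : differentiable chain_energy v.
Proof. exact: differentiable_quadratic_remainder chain_energy_remainder v. Qed.

Lemma grad_chain_energy v : grad chain_energy v = chain_grad v.
Proof. exact: grad_quadratic_remainder chain_energy_remainder v. Qed.

Lemma chain_energy_regular (mu L : R) : mu / 2 <= k * (1 - al) ^+ 2 ->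
  k * (1 + al) ^+ 2 <= L / 2 ->
  strongly_convex mu chain_energy /\ smooth L chain_energy.
Proof.
move=> muk kL; split; [|split]; first split.
- exact: differentiable_chain_energy.
- move=> x x'; rewrite sqr_enorm /bregman grad_chain_energy chain_energyB.
  apply: (@le_trans _ _ (k * (1 - al) ^+ 2 * dot (x - x') (x - x'))).
    by rewrite ler_wpM2r ?dot_ge0.
  by rewrite -mulrA ler_wpM2l// dot_chain_mx_ge.
- split; first exact: differentiable_chain_energy.
  move=> x x'; rewrite !mul0r /bregman grad_chain_energy chain_energyB.
  by rewrite mulr_ge0 ?dot_ge0.
- move=> x x'; rewrite sqr_enorm /bregman grad_chain_energy.
  apply: le_trans (chain_energy_remainder x x') _.
  by rewrite ler_wpM2r ?dot_ge0.
Qed.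

End chain_energy.

Section hard_problem.
Variables (R : realType) (m n : nat) (L k b : R) (s t : nat -> R).
Hypothesis L_gt0 : 0 < L.
Hypotheses (s_gt0 : forall i, 0 < s i) (s_decr : forall i, s i.+1 <= s i).
Implicit Types x : 'cV[R]_(m.+1 + n.+1).

(* The minimizer [chain_sol m t] of [hard_g] enters the linear term, which makes
   [usubmx x = 0] optimal for the primal problem. *)
Definition hard_f x : R :=
  L / 2 * dot (usubmx x) (usubmx x) - b * dot (chain_sol m t) (usubmx x) +
  chain_energy (L / 8) s (dsubmx x).

Definition hard_g : 'cV[R]_m.+1 -> R := chain_energy k t.

Definition hard_grad x : 'cV[R]_(m.+1 + n.+1) :=
  col_mx (L *: usubmx x - b *: chain_sol m t) (chain_grad (L / 8) s (dsubmx x)).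

Definition hard_sol : 'cV[R]_(m.+1 + n.+1) := col_mx 0 (chain_sol n s).

Let L8 : 0 <= L / 8. Proof. by rewrite divr_ge0// ltW. Qed.

Let s_decr1 i : s i.+1 <= 1 * s i. Proof. by rewrite mul1r. Qed.

Let le11 : (0 : R) <= 1 <= (1 : R). Proof. by rewrite ler01 lexx. Qed.

Lemma hard_fB x x' :
  hard_f x - hard_f x' - dot (hard_grad x') (x - x') =
  L / 2 * dot (usubmx x - usubmx x') (usubmx x - usubmx x') +
  L / 8 * dot (chain_mx n s *m (dsubmx x - dsubmx x'))
              (chain_mx n s *m (dsubmx x - dsubmx x')).
Proof.
rewrite -chain_energyB /hard_f (dot_block (hard_grad x')) /hard_grad.
rewrite col_mxKu col_mxKd !linearB /=; set v := dsubmx x; set v' := dsubmx x'.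
set u := usubmx x; set u' := usubmx x'; set ys := chain_sol m t.
by rewrite !(dotBl, dotBr, dotZl) (dotC u' u); field.
Qed.

Lemma hard_f_bregman x x' :
  0 <= hard_f x - hard_f x' - dot (hard_grad x') (x - x') <=
  L / 2 * dot (x - x') (x - x').
Proof.
have L2 : 0 <= L / 2 by rewrite divr_ge0// ltW.
rewrite hard_fB (dot_block (x - x')).
have -> : usubmx (x - x') = usubmx x - usubmx x' by exact: linearB.
have -> : dsubmx (x - x') = dsubmx x - dsubmx x' by exact: linearB.
apply/andP; split.
  by rewrite (addr_ge0 (mulr_ge0 L2 (dot_ge0 _)) (mulr_ge0 L8 (dot_ge0 _))).
rewrite mulrDr lerD2l; set w := dsubmx x - _.
(* A nonincreasing [s] corresponds to [al = 1], so the chain has squared norm at most 4; hence the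
   factor [L / 8]. *)
have -> : L / 2 = L / 8 * (1 + 1) ^+ 2 by field.
by rewrite -(mulrA (L / 8)) ler_wpM2l// dot_chain_mx_le.
Qed.

Let hard_f_remainder x x' :
  `|hard_f x - hard_f x' - dot (hard_grad x') (x - x')| <=
  L / 2 * dot (x - x') (x - x').
Proof. by have /andP[h0 hL] := hard_f_bregman x x'; rewrite ger0_norm. Qed.

(** The cast shows the dimension as a successor, the form required by the differentiation lemmas. *)
Lemma grad_hard_f x : grad (hard_f : 'cV_(m + n.+1).+1 -> R) x = hard_grad x.
Proof. exact: (@grad_quadratic_remainder _ (m + n.+1) _ _ _ hard_f_remainder x). Qed.

Lemma hard_f_regular :
  strongly_convex 0 (hard_f : 'cV_(m + n.+1).+1 -> R) /\
  smooth L (hard_f : 'cV_(m + n.+1).+1 -> R).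
Proof.
have scvx : strongly_convex 0 (hard_f : 'cV_(m + n.+1).+1 -> R).
  split=> [x|x x'].
    exact: (@differentiable_quadratic_remainder _ (m + n.+1) _ _ _ hard_f_remainder x).
  rewrite !mul0r /bregman grad_hard_f.
  by have /andP[] := hard_f_bregman x x'.
split=> //; split=> // x x'; rewrite sqr_enorm /bregman grad_hard_f.
exact: hard_f_remainder.
Qed.

End hard_problem.

(** * Primal solution and primal-dual gap of the hard problem *)

Section hard_solution.
Variables (R : realType) (m n : nat) (L k b : R) (s t : nat -> R).
Hypotheses (L_gt0 : 0 < L) (k_ge0 : 0 <= k).
Hypotheses (s_gt0 : forall i, 0 < s i).
Implicit Types (x : 'cV[R]_(m.+1 + n.+1)) (y : 'cV[R]_m.+1).

Local Notation B := (coupling m n.+1 b).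
Local Notation f := (hard_f (m := m) (n := n) L b s t).
Local Notation g := (hard_g (m := m) k t).
Local Notation sol := (hard_sol m n s).

Let L8 : 0 <= L / 8. Proof. by rewrite divr_ge0// ltW. Qed.

Let L2 : 0 <= L / 2. Proof. by rewrite divr_ge0// ltW. Qed.

Lemma hard_f_sol : f sol = 0.
Proof.
rewrite /hard_f col_mxKu col_mxKd !dot0r chain_energy_sol !mulr0; ring.
Qed.

(** Testing the supremum in [g^*] at the minimizer [chain_sol m t], where [g] vanishes, cancels the
    linear term of [f]. *)
Lemma primal_hard_ge x :
  ((L / 2 * dot (usubmx x) (usubmx x) +
    chain_energy (L / 8) s (dsubmx x))%:E <= primal B f g x)%E.
Proof.
apply: (@le_trans _ _ ((f x)%:E + (b * dot (chain_sol m t) (usubmx x))%:E)%E).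
  by rewrite -EFinD lee_fin /hard_f; lra.
rewrite /primal leeD2l//; apply: ereal_sup_ubound.
exists (chain_sol m t) => //; rewrite /hard_g chain_energy_sol subr0.
by rewrite mul_coupling dotZl dotC.
Qed.

Lemma primal_hard_sol : (primal B f g sol <= 0)%E.
Proof.
rewrite /primal hard_f_sol add0e; apply: ub_ereal_sup => _ [y _ <-].
rewrite mul_coupling col_mxKu scaler0 dot0l sub0r lee_fin oppr_le0.
exact: chain_energy_ge0.
Qed.

Lemma primal_hard_ge0 x : (0 <= primal B f g x)%E.
Proof.
apply: le_trans (primal_hard_ge x).
by rewrite lee_fin (addr_ge0 (mulr_ge0 L2 (dot_ge0 _)) (chain_energy_ge0 _ L8 _)).
Qed.

(** The optimal value is 0, so both nonnegative terms of the lower bound vanish at a solution;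
    injectivity of the chain then fixes the second block. *)
Lemma primal_solutions_hard : primal_solutions B f g = [set sol].
Proof.
apply/seteqP; split => [x xS|_ -> x]; last first.
  exact: le_trans primal_hard_sol (primal_hard_ge0 x).
have := le_trans (primal_hard_ge x) (le_trans (xS sol) primal_hard_sol).
rewrite lee_fin => x0.
have u0 : 0 <= L / 2 * dot (usubmx x) (usubmx x) by exact: mulr_ge0 L2 (dot_ge0 _).
have v0 := chain_energy_ge0 s L8 (dsubmx x).
have ux : usubmx x = 0.
  apply: dot_eq0; rewrite -(pmulr_rle0 _ (_ : 0 < L / 2)) ?divr_gt0//; lra.
have vx : dsubmx x - chain_sol n s = 0.
  apply: (chain_mx_inj (s := s)); apply: dot_eq0.
  by rewrite -(pmulr_rle0 _ (_ : 0 < L / 8)) ?divr_gt0// -/(chain_energy _ _ _); lra.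
by rewrite /= -[x]vsubmxK ux (subr0_eq vx).
Qed.

(** Testing [f^*] at [sol], where [f] vanishes and which is orthogonal to [B^T y], gives
    [D(y) <= - g(y)]. *)
Lemma hard_gap x y :
  ((g y)%:E + (chain_energy (L / 8) s (dsubmx x))%:E <=
   primal B f g x - dual B f g y)%E.
Proof.
rewrite addeC; apply: leeD.
  apply: le_trans (primal_hard_ge x).
  by rewrite lee_fin lerDr (mulr_ge0 L2 (dot_ge0 _)).
rewrite leeNr -EFinN /dual -[leRHS]adde0 leeD2l// oppe_le0.
apply: ereal_sup_ubound; exists sol => //.
rewrite hard_f_sol subr0 dotNl mul_tr_coupling dot_block.
by rewrite !col_mxKu !col_mxKd dot0r dot0l addr0 oppr0.
Qed.

End hard_solution.

(** * Propagation of supports through the memory *)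

Lemma ltr_mulS_gt0 (R : realType) (e r : R) (i : nat) :
  e <= r -> r < i.+1%:R * e -> (0 < i)%N.
Proof. by case: i => // er; rewrite mul1r ltNge er. Qed.

(** Entry [i] stays zero before time [(i + 1) e]; going back by one delay [e] lowers this index by
    one, matching the reach of [chain_grad_support]. *)
Lemma ltrB_mulS (R : realType) (e r : R) (i j : nat) : 0 < e ->
  (i <= j.+1)%N -> r < i.+1%:R * e -> r - e < j.+1%:R * e.
Proof.
move=> e0 ij ri; rewrite ltrBlDr; apply: (lt_le_trans ri).
by rewrite !mulr_natl -mulrSr ler_pMn2l.
Qed.

Section hard_memory.
Variables (R : realType) (m n : nat) (L k b al : R) (s t : nat -> R).
Hypotheses (L_gt0 : 0 < L) (k_ge0 : 0 <= k) (al01 : 0 <= al <= 1).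
Hypotheses (s_gt0 : forall i, 0 < s i) (s_decr : forall i, s i.+1 <= s i).
Hypotheses (t_gt0 : forall i, 0 < t i) (t_decr : forall i, t i.+1 <= al * t i).
Variables (tf tg tB : R).
Hypotheses (tf0 : 0 < tf) (tg0 : 0 < tg) (tB0 : 0 < tB).
Implicit Types (x : 'cV[R]_(m.+1 + n.+1)) (y : 'cV[R]_m.+1).

Local Notation B := (coupling m n.+1 b).
Local Notation f := (hard_f (m := m) (n := n) L b s t).
Local Notation g := (hard_g (m := m) k t).
Variable A : fo_method tf tg tB B f g.

(** Only gradients of [f] extend the support of the second block, one entry per [tf]: [B^T y]
    vanishes there, so the memory in [y] is left unconstrained. *)
Lemma mem_x_dsubmx_support (tau : R) x : 0 <= tau -> mem_x A tau x ->
  forall i : 'I_n.+1, tau < i.+1%:R * tf -> dsubmx x i 0 = 0.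
Proof.
move=> tau0.
pose Sx r : set 'cV[R]_(m.+1 + n.+1) :=
  [set x | forall i : 'I_n.+1, r < i.+1%:R * tf -> dsubmx x i 0 = 0].
pose Sy (r : R) : set 'cV[R]_m.+1 := setT.
have [||||| + _] := @memory_invariant _ _ _ _ _ _ _ _ _ Sx Sy tf0 tg0 tB0
  _ _ _ _ _ A tau tau0; last exact.
- move=> r; split=> [i _|a u v u0 v0 i ri]; first by rewrite !mxE.
  have := u0 i ri; have := v0 i ri; rewrite !mxE => -> ->.
  by rewrite mulr0 addr0.
- by [].
- move=> r {}x tfr xS; split=> i ri; first exact/xS/(ltrB_mulS tf0 _ ri).
  have -> : grad f x = hard_grad L b s t x by exact: grad_hard_f.
  rewrite col_mxKd mxE chain_grad_support ?mulr0//.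
    exact: ltr_mulS_gt0 tfr ri.
  by move=> j ij; exact/xS/(ltrB_mulS tf0 ij ri).
- by [].
- move=> r {}x y tBr xS _; split => // i ri.
    by apply: xS; rewrite ltrBlDr (lt_trans ri)// ltrDl.
  by rewrite mul_tr_coupling col_mxKd mxE.
Qed.

(** Before [tf] no gradient of [f] is available, and [B] and [B^T] merely rescale between [u] and
    [y], so the support grows only through gradients of [g], one entry per [tg]. *)
Lemma mem_y_support (tau : R) y : 0 <= tau < tf -> mem_y A tau y ->
  forall i : 'I_m.+1, tau < i.+1%:R * tg -> y i 0 = 0.
Proof.
case/andP=> tau0 tauf.
(* The guard [r < tf] makes the invariant vacuous as soon as a gradient of [f], whose first block
   involves all of [chain_sol m t], can enter. *)
pose S N (F : 'cV[R]_N -> 'cV[R]_m.+1) r : set 'cV[R]_N :=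
  [set x | r < tf -> forall i : 'I_m.+1, r < i.+1%:R * tg -> F x i 0 = 0].
pose Sx := S _ (fun x => usubmx x); pose Sy := S _ (fun y => y).
have lt_sub (e r u : R) : 0 < e -> r < u -> r - e < u.
  by move=> e0 ru; rewrite ltrBlDr (lt_trans ru)// ltrDl.
have [||||| _ SyA My] := @memory_invariant _ _ _ _ _ _ _ _ _ Sx Sy tf0 tg0 tB0
  _ _ _ _ _ A tau tau0; last exact: SyA My tauf.
- move=> r; split=> [rf i _|a u v u0 v0 rf i ri]; first by rewrite !mxE.
  have := u0 rf i ri; have := v0 rf i ri; rewrite !mxE => -> ->.
  by rewrite mulr0 addr0.
- move=> r; split=> [rf i _|a u v u0 v0 rf i ri]; first by rewrite !mxE.
  by rewrite !mxE u0// v0// mulr0 addr0.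
- by move=> r x tfr xS; split=> rf; move: (lt_le_trans rf tfr); rewrite ltxx.
- move=> r {}y tgr yS; split=> rf i ri.
    by apply: yS (ltrB_mulS tg0 _ ri) => //; exact: lt_sub.
  rewrite (grad_chain_energy k_ge0 t_gt0 al01 t_decr) mxE chain_grad_support ?mulr0//.
    exact: ltr_mulS_gt0 tgr ri.
  by move=> j ij; apply: yS (ltrB_mulS tg0 ij ri); exact: lt_sub.
- move=> r x {}y tBr xS yS; split => rf i ri.
  + by apply: xS; exact: lt_sub.
  + by apply: yS; exact: lt_sub.
  + by rewrite mul_tr_coupling col_mxKu mxE yS ?mulr0//; exact: lt_sub.
  + by rewrite mul_coupling mxE xS ?mulr0//; exact: lt_sub.
Qed.

End hard_memory.

(** * Choice of the parameters and the lower bounds *)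

Lemma dist_set1 (R : realType) n (x a : 'cV[R]_n) : dist x [set a] = enorm (x - a).
Proof. by rewrite /dist image_set1 inf1. Qed.

Lemma exists_chain_ratio (R : realType) (mu L : R) : 0 <= mu < L ->
  exists k al : R, [/\ 0 < k, 0 < al < 1, mu / 2 <= k * (1 - al) ^+ 2
                     & k * (1 + al) ^+ 2 <= L / 2].
Proof.
case/andP=> mu0 muL; have L0 : 0 < L by exact: le_lt_trans muL.
(* Then [mu = L (1 - 5 al)], which yields [mu (1 + al)^2 <= L (1 - al)^2]; [k] makes the smoothness
   bound an equality. *)
pose al := (L - mu) / (5 * L); pose k := L / 2 / (1 + al) ^+ 2.
have al0 : 0 < al by rewrite divr_gt0 ?subr_gt0 ?mulr_gt0.
have alL : al * (5 * L) = L - mu by rewrite /al divfK// gt_eqF// mulr_gt0.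
have al1 : al < 1 by nra.
have q0 : 0 < (1 + al) ^+ 2 by rewrite exprn_gt0// addr_gt0.
exists k, al; split; first by rewrite !divr_gt0.
- by rewrite al0.
- rewrite /k mulrAC ler_pdivlMr// mulrAC [leRHS]mulrAC ler_pM2r ?invr_gt0//.
  nra.
- by rewrite /k divfK ?gt_eqF.
Qed.

Definition two_level (R : realType) (N : nat) (a1 a2 : R) (i : nat) : R :=
  if (i < N)%N then a1 else a2.

Section two_level.
Variables (R : realType) (N1 N2 : nat) (a1 a2 : R).
Local Notation s := (two_level N1.+1 a1 a2).
Local Notation sol := (chain_sol (N1 + N2) s).

Lemma dot_two_level : dot sol sol = N1.+1%:R * a1 ^+ 2 + N2%:R * a2 ^+ 2.
Proof.
rewrite /dot (eq_bigr (fun i : 'I__ => s i ^+ 2)) => [|i _]; last by rewrite !mxE expr2.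
rewrite -(big_mkord xpredT (fun i => s i ^+ 2)) -addSn.
rewrite (big_cat_nat _ (n := N1.+1)) ?leq_addr//=.
rewrite big_nat (eq_bigr (fun=> a1 ^+ 2)) => [|i /andP[_ i1]]; last first.
  by rewrite /two_level i1.
rewrite -big_nat sumr_const_nat subn0 mulr_natl; congr (_ + _).
rewrite big_nat (eq_bigr (fun=> a2 ^+ 2)) => [|i /andP[i1 _]]; last first.
  by rewrite /two_level ltnNge i1.
by rewrite -big_nat sumr_const_nat addKn mulr_natl.
Qed.

(** All entries from [N1.+1 + N] on lie in the second block and vanish in [v]; starting there makes
    their number [N2 - N] independent of [N1]. *)
Lemma dot_two_level_tail N (v : 'cV[R]_(N1 + N2).+1) : (N <= N2)%N ->
  (forall i : 'I_(N1 + N2).+1, (N <= i)%N -> v i 0 = 0) ->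
  (N2 - N)%:R * a2 ^+ 2 <= dot (v - sol) (v - sol).
Proof.
move=> N2N v0.
have -> : (N2 - N)%:R * a2 ^+ 2 =
    \sum_(i < (N1 + N2).+1) if (N1.+1 + N <= i)%N then a2 ^+ 2 else 0.
  rewrite -big_mkcond /=.
  rewrite -(big_mkord (fun i => (N1.+1 + N <= i)%N) (fun=> a2 ^+ 2)) -addSn.
  rewrite (big_cat_nat _ (n := (N1.+1 + N)%N)) ?leq_add2l//=.
  rewrite big_nat_cond big1 => [|i]; last first.
    by case/andP=> /andP[_ i1] i2; move: i1; rewrite ltnNge i2.
  rewrite add0r big_nat_cond (eq_bigl (fun i => (N1.+1 + N <= i < N1.+1 + N2)%N)) => [|i].
    by rewrite -big_nat sumr_const_nat subnDl mulr_natl.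
  by rewrite andbAC andbb.
apply: ler_sum => i _; case: ifPn => [iN|_]; last by rewrite -expr2 sqr_ge0.
rewrite !mxE v0 ?(leq_trans _ iN) ?leq_addl// sub0r mulrNN -expr2.
by rewrite /two_level ltnNge (leq_trans _ iN)// leq_addr.
Qed.

End two_level.

(** [B B^T] is [muyx p ^+ 2] times the identity, so the bounds on [muyx p] are equalities whether or
    not the gradients of [g] lie in the range of [B]. *)
Lemma hard_regular (R : realType) (p : params R) (m n : nat) (k al : R)
    (s t : nat -> R) :
  admissible p -> mux p = 0 -> muxy p = 0 ->
  0 <= k -> 0 <= al <= 1 -> muy p / 2 <= k * (1 - al) ^+ 2 ->
  k * (1 + al) ^+ 2 <= Ly p / 2 ->
  (forall i, 0 < s i) -> (forall i, s i.+1 <= s i) ->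
  (forall i, 0 < t i) -> (forall i, t i.+1 <= al * t i) ->
  regular p (coupling m n.+1 (muyx p) : 'M[R]_(m.+1, (m + n.+1).+1))
    (@hard_f R m n (Lx p) (muyx p) s t) (@hard_g R m k t).
Proof.
case=> /andP[_ Lx0] _ _ /andP[yx0 yxL] _ x0 xy0 k0 al01 muk kL s0 sd t0 td.
rewrite x0 in Lx0.
split; rewrite ?x0 ?xy0 ?expr0n.
- exact: hard_f_regular.
- exact: chain_energy_regular td _ _ _ _.
- by split=> _; [exact: lambda_min_pos_tr_coupling|exact: lambda_min_tr_coupling].
- split=> _.
    by have := lambda_min_pos_coupling_tr m n.+1 (muyx p) => /= ->.
  by have := lambda_min_coupling_tr m n.+1 (muyx p) => /= ->.
- apply: le_trans (lambda_max_tr_coupling m n.+1 (muyx p)) _.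
  by rewrite lerXn2r ?nnegrE ?(le_trans yx0) ?(ltW yxL).
Qed.

(** With [N2 = N1.+1 + 2 N], more than a quarter of the second block, thus more than an eighth of
    [Rx^2], remains after [N] entries are removed. *)
Lemma ltn_double_tail (i j : nat) : (i.+1 + j.*2 < 4 * (i.+1 + j.*2 - j))%N.
Proof. by lia. Qed.

(** The instance depends on the horizon [T] through the length of the second block: the distance
    bound holds up to [T], the gap bound at every time. *)
Theorem theorem1 (R : realType) :
  exists2 c : R, 0 < c &
  forall (p : params R) (Rx eps tf tg tB : R),
    admissible p -> 0 < Rx -> 0 < eps -> 0 < tf -> 0 < tg -> 0 < tB ->
    ~ (0 < Num.min (delta_x p) (delta_y p)) -> delta_x p = 0 ->
  forall T : R, 0 < T ->
  exists (dx dy : nat) (B : 'M[R]_(dy.+1, dx.+1))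
         (f : 'cV[R]_dx.+1 -> R) (g : 'cV[R]_dy.+1 -> R),
    [/\ regular p B f g,
        dist 0 (primal_solutions B f g) = Rx,
        forall (A : fo_method tf tg tB B f g) (tau : R), 0 < tau <= T ->
          dist (out_x A tau) (primal_solutions B f g) ^+ 2 > 1 / 8 * Rx ^+ 2
      & forall (A : fo_method tf tg tB B f g) (tau : R), 0 <= tau ->
          (primal B f g (out_x A tau) - dual B f g (out_y A tau) < eps%:E)%E ->
          c * (tf * dist 0 (primal_solutions B f g) * Num.sqrt (Lx p / eps))
            <= tau].
Proof.
exists (1 / 8); first by rewrite divr_gt0.
move=> p Rx eps tf tg tB adm Rx0 eps0 tf0 tg0 tB0 _ dx0 T T0.
have [/andP[mux0 muxL] /andP[muy0 muyL] /andP[muxy0 _] _ _] := adm.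
have Lx0 : 0 < Lx p by exact: le_lt_trans muxL.
have Ly0 : 0 < Ly p by exact: le_lt_trans muyL.
have [mux_eq0 muxy_eq0] : mux p = 0 /\ muxy p = 0.
  move: dx0 => /eqP; rewrite paddr_eq0 ?divr_ge0 ?sqr_ge0 ?(ltW Ly0)//.
  by rewrite mulf_eq0 sqrf_eq0 invr_eq0 (gt_eqF Ly0) orbF => /andP[/eqP ? /eqP ?].
have [k [al [k0 /andP[al0 al1] muk kL]]] := exists_chain_ratio (introT andP (conj muy0 muyL)).
have al01 : 0 <= al <= 1 by rewrite !ltW.
(* The chain in [y] is so long that its last entry is still zero before [tf]. *)
pose m := Num.bound (tf / tg).
have tfm : tf < m.+1%:R * tg.
  rewrite -ltr_pdivrMr// (lt_trans (archi_boundP _)) ?ltr_nat//.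
  by rewrite divr_ge0// ltW.
pose K := Rx * Num.sqrt (Lx p / eps).
have K0 : 0 < K by rewrite mulr_gt0// sqrtr_gt0 divr_gt0.
(* [N1.+1] is the length of the first block of [s], [N2] that of the second. *)
pose N1 := Num.truncn (K / 8).
have /andP[N1K KN1] : N1%:R <= K / 8 < N1.+1%:R by apply: truncn_itv; rewrite divr_ge0// ltW.
pose N := Num.bound (T / tf).
have TN : T < N%:R * tf.
  by rewrite -ltr_pdivrMr// archi_boundP// divr_ge0// ltW.
(* At most [N] entries are revealed by time [T]; [N2 >= N1.+1] ensures [a2 <= a1], so that [s] is
   nonincreasing. *)
pose N2 := (N1.+1 + N.*2)%N.
pose a1 := Rx / Num.sqrt (2 * N1.+1%:R); pose a2 := Rx / Num.sqrt (2 * N2%:R).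
have N10 : 0 < N1.+1%:R :> R by rewrite ltr0n.
have N20 : 0 < N2%:R :> R by rewrite ltr0n.
have sqr_a (j : R) : 0 < j -> (Rx / Num.sqrt (2 * j)) ^+ 2 = Rx ^+ 2 / (2 * j).
  by move=> j0; rewrite expr_div_n sqr_sqrtr// mulr_ge0// ltW.
have a1_gt0 : 0 < a1 by rewrite divr_gt0// sqrtr_gt0 mulr_gt0.
have a2_gt0 : 0 < a2 by rewrite divr_gt0// sqrtr_gt0 mulr_gt0.
have a21 : a2 <= a1.
  rewrite ler_wpM2l ?(ltW Rx0)// lef_pV2 ?posrE ?sqrtr_gt0 ?mulr_gt0//.
  by rewrite ler_wsqrtr// ler_wpM2l// ler_nat leq_addr.
pose n := (N1 + N2)%N; pose s := two_level N1.+1 a1 a2.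
have s0 i : 0 < s i by rewrite /s /two_level; case: ifP.
have sd i : s i.+1 <= s i.
  rewrite /s /two_level; case: ifPn => [i1|_]; first by rewrite (ltn_trans _ i1).
  by case: ifP.
(* The last entry [t m] equals [a], chosen so that missing it alone costs [eps] by the lower bound
   on the chain. *)
pose a := Num.sqrt (eps / (k * (1 - al) ^+ 2)); pose t i := a / al ^+ m * al ^+ i.
have kal0 : 0 < k * (1 - al) ^+ 2 by rewrite mulr_gt0// exprn_gt0// subr_gt0.
have a0 : 0 < a by rewrite sqrtr_gt0 divr_gt0.
have t0 i : 0 < t i by rewrite mulr_gt0 ?divr_gt0 ?exprn_gt0.
have td i : t i.+1 <= al * t i by rewrite /t exprS mulrCA.
have tm : k * (1 - al) ^+ 2 * t m ^+ 2 = eps.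
  rewrite /t divfK ?expf_neq0 ?gt_eqF// sqr_sqrtr ?divr_ge0 ?ltW//.
  by rewrite mulrCA mulfV ?mulr1 ?gt_eqF.
pose f : 'cV[R]_(m.+1 + n.+1) -> R := hard_f (Lx p) (muyx p) s t.
pose g : 'cV[R]_m.+1 -> R := hard_g k t.
have SE : primal_solutions (coupling m n.+1 (muyx p)) f g = [set hard_sol m n s].
  by apply: primal_solutions_hard => //; exact: ltW.
have solE : dot (chain_sol n s) (chain_sol n s) = Rx ^+ 2.
  rewrite dot_two_level !sqr_a//; field.
  by rewrite !gt_eqF.
have distE : dist 0 (primal_solutions (coupling m n.+1 (muyx p)) f g) = Rx.
  rewrite SE dist_set1 sub0r /enorm dotNl dotNr opprK dot_block.
  by rewrite !col_mxKu !col_mxKd dot0r add0r solE sqrtr_sqr gtr0_norm.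
exists (m + n.+1)%N, m, (coupling m n.+1 (muyx p)), f, g; split.
- by apply: hard_regular muk kL s0 sd t0 td => //; exact: ltW.
- exact: distE.
- move=> A tau /andP[tau0 tauT]; pose x : 'cV[R]_(m.+1 + n.+1) := out_x A tau.
  have supp : forall i : 'I_n.+1, tau < i.+1%:R * tf -> dsubmx x i 0 = 0.
    exact: (@mem_x_dsubmx_support _ m n (Lx p) k (muyx p) s t Lx0 s0 sd
      _ _ _ tf0 tg0 tB0 A _ _ (ltW tau0) (out_xP A (ltW tau0))).
  have -> : dist (out_x A tau) (primal_solutions (dx := (m + n.+1).+1)
      (dy := m.+1) (coupling m n.+1 (muyx p)) f g) = enorm (x - hard_sol m n s).
    by rewrite -dist_set1 -SE.
  rewrite sqr_enorm; apply: (@lt_le_trans _ _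
    (dot (dsubmx x - chain_sol n s) (dsubmx x - chain_sol n s))); last first.
    have -> : dsubmx x - chain_sol n s = dsubmx (x - hard_sol m n s).
      by rewrite linearB /= col_mxKd.
    by rewrite (dot_block (x - hard_sol m n s)) lerDr dot_ge0.
  have NN2 : (N <= N2)%N by rewrite /N2 -addnn addnA leq_addl.
  apply: (@lt_le_trans _ _ ((N2 - N)%:R * a2 ^+ 2)); last first.
    apply: dot_two_level_tail => // i Ni; apply/supp/(le_lt_trans tauT)/(lt_le_trans TN).
    by rewrite ler_pM2r// ler_nat leqW.
  have N24 : N2%:R < 4 * (N2 - N)%:R :> R 
    by rewrite -natrM ltr_nat ltn_double_tail.
  rewrite sqr_a// -subr_gt0; set D := (N2 - N)%:R in N24 *.
  have -> : D * (Rx ^+ 2 / (2 * N2%:R)) - 1 / 8 * Rx ^+ 2 =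
            (4 * D - N2%:R) * (Rx ^+ 2 / (8 * N2%:R)).
    by field; rewrite gt_eqF.
  by rewrite mulr_gt0 ?subr_gt0// divr_gt0 ?exprn_gt0 ?mulr_gt0.
- move=> A tau tau0 gap; rewrite [dist _ _]distE.
  pose x : 'cV[R]_(m.+1 + n.+1) := out_x A tau.
  have := le_lt_trans (hard_gap k (muyx p) s t Lx0 x (out_y A tau)) gap.
  rewrite -EFinD lte_fin => gE.
  rewrite leNgt; apply/negP => tauK.
  have g0 := chain_energy_ge0 t (ltW k0) (out_y A tau).
  have Lx8 : 0 <= Lx p / 8 by rewrite divr_ge0// ltW.
  have E0 := chain_energy_ge0 s Lx8 (dsubmx x).
  (* Before [tf] the last entry of [y] is zero, so [g] alone would be at least [eps]. *)
  have tftau : tf <= tau.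
    rewrite leNgt; apply/negP => tautf.
    have tt : 0 <= tau < tf by rewrite tau0.
    have ym := mem_y_support (ltW k0) al01 t0 td tf0 tg0 tB0 tt
      (out_yP A tau0) (i := ord_max) (lt_trans tautf tfm).
    suff : eps <= hard_g k t (out_y A tau) by move: gE; rewrite /hard_g; lra.
    rewrite -tm /hard_g /chain_energy -mulrA ler_wpM2l ?(ltW k0)//.
    apply: le_trans (dot_chain_mx_ge t0 al01 td _).
    rewrite ler_wpM2l ?sqr_ge0//.
    apply: le_trans (sqr_coord_le_dot _ ord_max).
    by rewrite !mxE ym sub0r sqrrN.
  have K8 : tau < K / 8 * tf by move: tauK; rewrite /K; lra.
  (* From [tau >= tf]; this later absorbs the rounding in [N1.+1 <= K / 8 + 1 <= K / 4]. *)
  have K8_gt1 : 1 < K / 8.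
    by rewrite -(ltr_pM2r tf0) mul1r (le_lt_trans tftau).
  have N1n : (N1 < n.+1)%N by rewrite ltnS leq_addr.
  have xN1 : dsubmx x (Ordinal N1n) 0 = 0.
    apply: (@mem_x_dsubmx_support _ m n (Lx p) k (muyx p) s t Lx0 s0 sd
      _ _ _ tf0 tg0 tB0 A _ _ tau0 (out_xP A tau0)).
    by apply: lt_trans K8 _; rewrite ltr_pM2r.
  have := chain_gap (s := s) a1_gt0 _ xN1.
  rewrite sqr_a//; set D := dot (chain_mx _ _ *m _) _ => gapD.
  have {gapD} : Rx ^+ 2 / (2 * N1.+1%:R) <= N1.+1%:R * D.
    by apply: gapD => i iN; rewrite /s /two_level ltnS iN.
  rewrite ler_pdivrMr ?mulr_gt0// => RD.
  have LD : Lx p * D < 8 * eps.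
    by move: gE; rewrite /chain_energy -/D /hard_g; lra.
  have D0 : 0 <= D := dot_ge0 _.
  have K2 : K ^+ 2 * eps = Rx ^+ 2 * Lx p.
    rewrite exprMn sqr_sqrtr ?divr_ge0 ?ltW//; field.
    by rewrite gt_eqF.
  have N1K4 : N1.+1%:R <= K / 4 :> R by rewrite -natr1; lra.
  (* From [Rx^2 <= 2 (N1 + 1)^2 D]. Multiplied by [Lx p], it reads
     [K^2 eps <= K^2 / 8 * (Lx p * D)], against [Lx p * D < 8 eps]. *)
  have : Rx ^+ 2 <= K ^+ 2 / 8 * D.
    apply: le_trans RD _; rewrite mulrAC ler_wpM2r//.
    have : N1.+1%:R ^+ 2 <= (K / 4) ^+ 2 :> R.
      by rewrite lerXn2r ?nnegrE// divr_ge0// (ltW K0).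
    by lra.
  rewrite -(ler_pM2r Lx0) -K2 => KD.
  have : K ^+ 2 / 8 * (Lx p * D) < K ^+ 2 / 8 * (8 * eps).
    by rewrite ltr_pM2l ?divr_gt0 ?exprn_gt0.
  by lra.
Qed.
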